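(* Let $(M_n(x,q))_{n\ge 0}$ be the generalized $q$-Morgan-Voyce polynomials with arbitrary initial values $M_0(x,q)$ and $M_1(x,q)$, and let $f(z)=\sum_{n=0}^{\infty}M_n(x,q)z^n$ be their generating function. Then $$\sum_{n=0}^{\infty}M_{n}(x,q)z^{n}=\frac{M_{0}(x,q)+\left(M_{1}(x,q)-(x+1+q)M_{0}(x,q)\right)z}{1-(x+1+q)z+z^{2}\eta_{z}}.$$
   Context: Here $x,q$ are complex numbers with $q\neq 1$. The generalized $q$-Morgan-Voyce polynomials are defined, for arbitrary initial values $M_0(x,q)$, $M_1(x,q)$, by $M_{n}(x,q)=(x+1+q)M_{n-1}(x,q)-q^{n-2}M_{n-2}(x,q)$ for $n\ge 2$. Generating functions are formal power series in $z$ (coefficients complex). The Fibonacci operator $\eta_z$ acts on formal power series by $\eta_z f(z)=f(qz)$. The expression $1-(x+1+q)z+z^2\eta_z$ denotes the linear operator $L$ on formal power series given by $(Lf)(z)=f(z)-(x+1+q)z f(z)+z^2 f(qz)$; it is invertible, and the fraction $\frac{N(z)}{1-(x+1+q)z+z^2\eta_z}$ denotes $L^{-1}N(z)$, i.e. the unique formal power series $F$ with $LF=N$. *)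

(* Defs.v *)
(* The complex numbers are taken to be R[i] for R : realType. *)
From HB Require Import structures.
From mathcomp Require Import all_boot all_order all_algebra.
From mathcomp Require Import boolp classical_sets reals.
From mathcomp Require Import complex.

Set Implicit Arguments.
Unset Strict Implicit.
Unset Printing Implicit Defensive.

Import GRing.Theory.
Local Open Scope ring_scope.

(* [FPS a] is the series \sum_n a n z^n.  A record rather than a plain function
   type, so that the product is the Cauchy product and not the pointwise one. *)
Record fps (K : Type) := FPS { fcoef : nat -> K }.

Section FormalPowerSeries.
Variable K : comNzRingType.
Implicit Types (f g h : fps K) (a b : K).

HB.instance Definition _ := gen_eqMixin (fps K).
HB.instance Definition _ := gen_choiceMixin (fps K).

Lemma fpsP f g : fcoef f =1 fcoef g -> f = g.
Proof. by case: f g => [u] [v] /= /funext ->. Qed.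

Definition fps0 : fps K := FPS (fun=> 0).
Definition fps_opp f : fps K := FPS (fun n => - fcoef f n).
Definition fps_add f g : fps K := FPS (fun n => fcoef f n + fcoef g n).

Fact fps_addA : associative fps_add.
Proof. by move=> f g h; apply: fpsP => n /=; rewrite addrA. Qed.
Fact fps_addC : commutative fps_add.
Proof. by move=> f g; apply: fpsP => n /=; rewrite addrC. Qed.
Fact fps_add0 : left_id fps0 fps_add.
Proof. by move=> f; apply: fpsP => n /=; rewrite add0r. Qed.
Fact fps_addN : left_inverse fps0 fps_opp fps_add.
Proof. by move=> f; apply: fpsP => n /=; rewrite addNr. Qed.

HB.instance Definition _ :=
  GRing.isZmodule.Build (fps K) fps_addA fps_addC fps_add0 fps_addN.

Definition fpsC a : fps K := FPS (fun n => if n is 0 then a else 0).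
Definition fps_mul f g : fps K :=
  FPS (fun n => \sum_(i < n.+1) fcoef f i * fcoef g (n - i)).

Definition fps_trunc N f : {poly K} := \poly_(i < N) fcoef f i.

Fact coef_mul_trunc N n f g :
  (n < N)%N -> fcoef (fps_mul f g) n = (fps_trunc N f * fps_trunc N g)`_n.
Proof.
move=> nN; rewrite coefM /=; apply: eq_bigr => i _.
rewrite !coef_poly (leq_ltn_trans (leq_subr i n) nN).
by rewrite (leq_ltn_trans _ nN) // -ltnS.
Qed.

Fact fps_mulC : commutative fps_mul.
Proof.
by move=> f g; apply: fpsP => n; rewrite !(@coef_mul_trunc n.+1) // mulrC.
Qed.

Fact fps_mulA : associative fps_mul.
Proof.
move=> f g h; apply: fpsP => n.
transitivity ((fps_trunc n.+1 f * (fps_trunc n.+1 g * fps_trunc n.+1 h))`_n).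
  rewrite coefM; apply: eq_bigr => i _.
  rewrite (@coef_mul_trunc n.+1) ?ltnS ?leq_subr // [(fps_trunc _ f)`__]coef_poly.
  by rewrite ltn_ord.
rewrite mulrA coefM; apply: eq_bigr => i _.
by rewrite (@coef_mul_trunc n.+1) ?ltn_ord // [(fps_trunc _ h)`__]coef_poly ltnS leq_subr.
Qed.

Fact fps_mul1 : left_id (fpsC 1) fps_mul.
Proof.
move=> f; apply: fpsP => n /=; rewrite big_ord_recl /= mul1r subn0.
by rewrite big1 ?addr0 // => i _; rewrite mul0r.
Qed.

Fact fps_mulDl : left_distributive fps_mul fps_add.
Proof.
move=> f g h; apply: fpsP => n /=; rewrite -big_split /=.
by apply: eq_bigr => i _; rewrite mulrDl.
Qed.

Fact fps_oner_neq0 : fpsC 1 != 0.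
Proof.
by apply/eqP => /(congr1 (fun f => fcoef f 0)) /eqP; rewrite oner_eq0.
Qed.

HB.instance Definition _ := GRing.Zmodule_isComNzRing.Build (fps K)
  fps_mulA fps_mulC fps_mul1 fps_mulDl fps_oner_neq0.

Definition fpsX : fps K := FPS (fun n => (n == 1%N)%:R).

(* The substitution f(z) |-> f(q z). *)
Definition fibonacci_op (q : K) f : fps K := FPS (fun n => q ^+ n * fcoef f n).

(* The series L^-1 N, i.e. the F such that L F = N.  It is meaningful when L is
   bijective (see [fps_opdivP]); it defaults to 0 if there is no such F. *)
Definition fps_opdiv (N : fps K) (L : fps K -> fps K) : fps K :=
  xget 0 [set F | L F = N]%classic.

Lemma fps_opdivP (L : fps K -> fps K) (N F : fps K) :
  bijective L -> fps_opdiv N L = F <-> L F = N.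
Proof.
case=> g gK Kg; split=> [<-|LF]; rewrite /fps_opdiv.
  by apply: (@xgetI _ _ [set F | L F = N]%classic (g N)) => /=.
by apply: xget_unique => //= G LG; rewrite -(gK G) LG -LF gK.
Qed.

(* The operator 1 - (x + 1 + q) z + z^2 eta_z. *)
Definition qMV_op (x q : K) (f : fps K) : fps K :=
  f - fpsC (x + 1 + q) * fpsX * f + fpsX ^+ 2 * fibonacci_op q f.

Lemma fcoefCM a f n : fcoef (fpsC a * f) n = a * fcoef f n.
Proof.
rewrite /= big_ord_recl /= subn0 big1 ?addr0 // => i _.
by rewrite mul0r.
Qed.

Lemma fcoefXM f n : fcoef (fpsX * f) n = if n is m.+1 then fcoef f m else 0.
Proof.
rewrite /= big_ord_recl /= mul0r add0r; case: n => [|n]; first by rewrite big_ord0.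
rewrite big_ord_recl /= mul1r subSS subn0 big1 ?addr0 // => i _.
by rewrite mul0r.
Qed.

Lemma fcoef_qMV_op x q f n :
  fcoef (qMV_op x q f) n =
  match n with
  | 0 => fcoef f 0
  | 1 => fcoef f 1 - (x + 1 + q) * fcoef f 0
  | m.+2 => fcoef f m.+2 - (x + 1 + q) * fcoef f m.+1 + q ^+ m * fcoef f m
  end.
Proof.
rewrite /qMV_op -mulrA expr2 -mulrA.
rewrite -[LHS]/(fcoef f n - fcoef (fpsC (x + 1 + q) * (fpsX * f)) n
  + fcoef (fpsX * (fpsX * fibonacci_op q f)) n).
rewrite fcoefCM !fcoefXM; case: n => [|[|n]]; rewrite ?fcoefXM //.
  by rewrite mulr0 subr0 addr0.
by rewrite addr0.
Qed.

Lemma qMV_op_bij (x q : K) : bijective (qMV_op x q).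
Proof.
pose c := x + 1 + q.
pose inv (N : fps K) := fix u n : K := match n with
  | 0 => fcoef N 0
  | n'.+1 => if n' is m.+1 then fcoef N n + c * u n' - q ^+ m * u m
             else fcoef N 1 + c * u n'
  end.
exists (fun N => FPS (inv N)) => [f|N]; apply: fpsP => n; last first.
  rewrite fcoef_qMV_op -/c; case: n => [|[|n]] //=; first by rewrite addrK.
  by rewrite addrAC subrK addrK.
suff [] : inv (qMV_op x q f) n = fcoef f n /\
  inv (qMV_op x q f) n.+1 = fcoef f n.+1 by [].
elim: n => [|n [IH0 IH1]].
  by rewrite /inv !fcoef_qMV_op -/c subrK.
split=> //; transitivity (fcoef (qMV_op x q f) n.+2
  + c * inv (qMV_op x q f) n.+1 - q ^+ n * inv (qMV_op x q f) n) => //.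
by rewrite IH0 IH1 fcoef_qMV_op -/c addrAC addrK subrK.
Qed.

(* M_n(x, q), with initial values the arbitrary functions M0 and M1. *)
Fixpoint qMorganVoyce (M0 M1 : K -> K -> K) (n : nat) (x q : K) : K :=
  match n with
  | 0 => M0 x q
  | n'.+1 => if n' is m.+1 then
               (x + 1 + q) * qMorganVoyce M0 M1 n' x q
               - q ^+ (n - 2)%N * qMorganVoyce M0 M1 m x q
             else M1 x q
  end.

End FormalPowerSeries.

Arguments fpsX {K}.

(* Main.v *)
Require Import Defs.
From mathcomp Require Import all_boot all_order all_algebra.
From mathcomp Require Import boolp classical_sets reals.
From mathcomp Require Import complex.

Import GRing.Theory.
Local Open Scope ring_scope.

(** Since [qMV_op x q] is bijective, the quotient is the generating function as soon as the operator
    maps that series to the numerator. In degree at least 2 the coefficients of the image vanish by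
    the recurrence; degrees 0 and 1 give the numerator. *)

Theorem theorem5 (R : realType) (M0 M1 : R[i] -> R[i] -> R[i]) (x q : R[i])
    (hq : q != 1) :
  let M n := qMorganVoyce M0 M1 n x q in
  FPS M =
  fps_opdiv (fpsC (M 0%N) + fpsC (M 1%N - (x + 1 + q) * M 0%N) * fpsX)
            (qMV_op x q).
Proof.
move=> M; apply/esym/fps_opdivP; first exact: qMV_op_bij.
apply: fpsP => n.
rewrite fcoef_qMV_op -[RHS]/(fcoef (fpsC (M 0%N)) n
  + fcoef (fpsC (M 1%N - (x + 1 + q) * M 0%N) * fpsX) n) fcoefCM.
case: n => [|[|n]] /=.
- by rewrite mulr0 addr0.
- by rewrite mulr1 add0r.
(* The recurrence at index [n.+2] carries [q ^+ (n.+2 - 2)], which must become the [q ^+ n] produced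
   by the substitution z -> qz. *)
- by rewrite mulr0 addr0 /M /= (subn2 n.+2) /= addrAC subrK subrr.
Qed.
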